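(* For every instance of the problem $P2,S1|s_j,t_j|C_{max}$, the constraints $$\sum_{j \in \mathcal{N}_1,\ j<i} x_{j,k-1} \ \ge\ x_{i,k} \qquad \forall i \in \mathcal{N}_1,\ \forall k \in M\setminus\{1\}$$ are valid symmetry-breaking constraints for the formulation $CF$, i.e. adding them to $CF$ does not change its optimal value.
   Context: An instance of $P2,S1|s_j,t_j|C_{max}$ consists of $n$ independent jobs $J_1,\dots,J_n$, each with loading time $s_j>0$, integer processing time $p_j>0$ and unloading time $t_j>0$; two identical machines $M=\{1,2\}$; and a single server. Put $A_j=s_j+p_j+t_j$. Each job is loaded, processed and unloaded on one machine, without delay between the three operations; loading and unloading occupy the server as well as the machine. Identify jobs with indices: $\mathcal{N}_1=\{1,\dots,n\}$ (jobs), $\mathcal{N}_2=\{n+1,\dots,2n\}$ (loading dummy jobs), $\mathcal{N}_3=\{2n+1,\dots,3n\}$ (unloading dummy jobs). Let $\rho_j=A_j$ for $j\in\mathcal{N}_1$, $\rho_j=s_{j-n}$ for $j\in\mathcal{N}_2$, $\rho_j=t_{j-2n}$ for $j\in\mathcal{N}_3$. Let $B$ be a large positive integer. The mixed-integer formulation $CF$ has continuous variables $C_{max}$ and $C_i$ ($i\in\mathcal{N}_1\cup\mathcal{N}_2\cup\mathcal{N}_3$), and binary variables $x_{i,k}$ ($i\in\mathcal{N}_1,k\in M$), $z_{i,j}$ ($i\neq j\in\mathcal{N}_1$), $y_{i,j}$ ($i\ne j\in\mathcal{N}_2\cup\mathcal{N}_3$). It minimizes $C_{max}$ subject to: - $C_{max}\ge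 C_i$ for all $i\in\mathcal{N}_1$; - $\sum_{k\in M}x_{i,k}=1$ for all $i\in\mathcal{N}_1$; - $C_i\ge\rho_i$ for all $i\in\mathcal{N}_1\cup\mathcal{N}_2\cup\mathcal{N}_3$; - $C_i+\rho_j\le C_j+B(3-x_{i,k}-x_{j,k}-z_{i,j})$ for all $i\ne j\in\mathcal{N}_1$, $k\in M$; - $z_{i,j}+z_{j,i}=1$ for all $i\neq j\in\mathcal{N}_1$; - $C_i+\rho_j\le C_j+B(1-y_{i,j})$ for all $i\ne j\in\mathcal{N}_2\cup\mathcal{N}_3$; - $y_{i,j}+y_{j,i}=1$ for all $i\neq j\in\mathcal{N}_2\cup\mathcal{N}_3$; - $C_i=C_{i+n}+\rho_i-\rho_{i+n}$ for all $i\in\mathcal{N}_1$; - $C_i=C_{i+2n}$ for all $i\in\mathcal{N}_1$. *)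

(* Defs.v *)
From HB Require Import structures.
From mathcomp Require Import all_boot all_order all_algebra.
From mathcomp Require Import all_classical all_reals all_analysis.

Set Implicit Arguments.
Unset Strict Implicit.
Unset Printing Implicit Defensive.

Import Order.TTheory GRing.Theory Num.Theory.

Local Open Scope classical_set_scope.
Local Open Scope ring_scope.

(* Jobs are numbered from 1; the values of [load], [proc] and [unload] outside
   1, ..., njobs are never used. *)
Record instance (R : realType) := Instance {
  njobs : nat;
  load : nat -> R;
  proc : nat -> nat;
  unload : nat -> R;
  load_gt0 : forall j : nat, (1 <= j <= njobs)%N -> 0 < load j;
  proc_gt0 : forall j : nat, (1 <= j <= njobs)%N -> (0 < proc j)%N;
  unload_gt0 : forall j : nat, (1 <= j <= njobs)%N -> 0 < unload j
}.

Definition machines : seq nat := [:: 1%N; 2%N].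

Section Formulation.

Variables (R : realType) (I : instance R).

Let n := njobs I.

(* {1, ..., n}, {n+1, ..., 2n} and {2n+1, ..., 3n} *)
Definition N1 : seq nat := iota 1 n.
Definition N2 : seq nat := iota (n + 1) n.
Definition N3 : seq nat := iota (2 * n + 1) n.

Definition joblen (j : nat) : R := load I j + (proc I j)%:R + unload I j.

Definition rho (j : nat) : R :=
  if (j <= n)%N then joblen j
  else if (j <= 2 * n)%N then load I (j - n)%N
  else unload I (j - 2 * n)%N.

(* Binary variables are booleans, coerced to 0 or 1.  Every family is a total
   function on nat; entries outside the index sets of the formulation occur
   in no constraint and not in the objective. *)
Record assignment := Assignment {
  Cmax : R;
  C : nat -> R;
  x : nat -> nat -> bool;
  z : nat -> nat -> bool;
  y : nat -> nat -> bool
}.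

Record CF (B : nat) (a : assignment) : Prop := MkCF {
  CF_makespan : forall i, i \in N1 -> C a i <= Cmax a;
  CF_assign : forall i, i \in N1 -> (\sum_(k <- machines) x a i k = 1)%N;
  CF_release : forall i, i \in N1 ++ N2 ++ N3 -> rho i <= C a i;
  CF_machine : forall i j k, i \in N1 -> j \in N1 -> i != j ->
    k \in machines ->
    C a i + rho j
      <= C a j + B%:R * (3 - (x a i k)%:R - (x a j k)%:R - (z a i j)%:R);
  CF_machine_order : forall i j, i \in N1 -> j \in N1 -> i != j ->
    (z a i j + z a j i = 1)%N;
  CF_server : forall i j, i \in N2 ++ N3 -> j \in N2 ++ N3 -> i != j ->
    C a i + rho j <= C a j + B%:R * (1 - (y a i j)%:R);
  CF_server_order : forall i j, i \in N2 ++ N3 -> j \in N2 ++ N3 -> i != j ->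
    (y a i j + y a j i = 1)%N;
  CF_load : forall i, i \in N1 -> C a i = C a (i + n)%N + rho i - rho (i + n)%N;
  CF_unload : forall i, i \in N1 -> C a i = C a (i + 2 * n)%N
}.

Definition symmetry_breaking (a : assignment) : Prop :=
  forall i k, i \in N1 -> k \in machines -> k != 1%N ->
    (\sum_(j <- N1 | (j < i)%N) x a j (k - 1)%N >= x a i k)%N.

(* Optimal value of minimizing Cmax over a feasible set; +oo if it is empty. *)
Definition optimal_value (feasible : set assignment) : \bar R :=
  ereal_inf [set (Cmax a)%:E | a in feasible].

End Formulation.

(* Main.v *)
Require Import Defs.
From mathcomp Require Import all_boot all_order all_algebra.
From mathcomp Require Import all_classical all_reals all_analysis.

Local Open Scope classical_set_scope.

(** The two machines are identical, so exchanging their names turns a feasible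
    assignment into a feasible one with the same makespan ([CF_swap]).  The
    symmetry-breaking constraints only ask that job 1 run on machine 1: at
    [i = 1] the sum is empty, which forbids machine 2 to job 1, and once job 1
    is on machine 1 it contributes a term 1 to the sum of every later job
    ([symmetry_breaking_job1]).  As job 1 is on one of the two machines, every
    feasible assignment satisfies the constraints either as it stands or after
    the exchange.  Hence both problems have the same set of attained makespans,
    and therefore the same infimum. *)

(** The map [k |-> 3 - k] is the transposition of the machines 1 and 2. *)
Definition swap_machines {R : realType} (a : assignment R) : assignment R :=
  Assignment (Cmax a) (C a) (fun i k => x a i (3 - k)%N) (z a) (y a).

(** The machine index is bound only in the assignment constraint, a sum over
    both machines, and in the machine constraint, stated for each machine; both
    are invariant under a permutation of the machines. *)
Lemma CF_swap {R : realType} {I : instance R} {B : nat} {a : assignment R} :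
  CF I B a -> CF I B (swap_machines a).
Proof.
case=> Hmk Has Hrel Hmach Hzo Hserv Hyo Hl Hu; split=> //=.
- move=> i iN; have := Has i iN; rewrite /machines !big_cons !big_nil !addn0.
  by rewrite [LHS]addnC.
- move=> i j k iN jN ij km; apply: Hmach => //.
  by move: km; rewrite !inE => /orP[] /eqP ->.
Qed.

Lemma job1_in_N1 {R : realType} {I : instance R} {i : nat} :
  i \in N1 I -> 1%N \in N1 I.
Proof.
by rewrite !mem_iota => /andP[i_gt0 i_le] /=; apply: leq_ltn_trans i_le.
Qed.

Lemma CF_machine1_or_machine2 {R : realType} {I : instance R} {B : nat}
    {a : assignment R} {i : nat} :
  CF I B a -> i \in N1 I -> x a i 2 = ~~ x a i 1.
Proof.
move=> Ha /(CF_assign Ha); rewrite /machines !big_cons big_nil.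
by case: (x a i 1); case: (x a i 2).
Qed.

Lemma symmetry_breaking_job1 {R : realType} {I : instance R} {B : nat}
    {a : assignment R} :
  CF I B a -> x a 1 1 -> symmetry_breaking I a.
Proof.
move=> Ha x11 i k iN; rewrite !inE => /orP[] /eqP -> // _.
have [i1|i_neq1] := eqVneq i 1%N.
  by rewrite i1 in iN *; rewrite (CF_machine1_or_machine2 Ha iN) x11.
have lt1i : (1 < i)%N.
  by rewrite ltn_neqAle eq_sym i_neq1; move: iN; rewrite mem_iota => /andP[].
rewrite (big_rem 1%N) ?(job1_in_N1 iN) //= lt1i subn1 /= x11.
by apply: leq_trans (leq_addr _ _); case: (x a i 2).
Qed.

Theorem proposition2 (R : realType) (I : instance R) (B : nat) (hB : (0 < B)%N) :
  optimal_value [set a : assignment R | CF I B a /\ symmetry_breaking I a]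
  = optimal_value [set a : assignment R | CF I B a].
Proof.
rewrite /optimal_value; congr ereal_inf; apply/seteqP; split.
  by move=> _ [a [Ha _] <-]; exists a.
move=> _ [a Ha <-].
have [x11|x11] := boolP (x a 1 1).
  by exists a => //; split=> //; apply: symmetry_breaking_job1 Ha x11.
exists (swap_machines a) => //; split; first exact: CF_swap.
(* Without jobs [x a 1 1] is unconstrained; any constraint to be checked is
   indexed by a job, so job 1 exists and is on machine 2 before the exchange. *)
move=> i k iN; have x12 : x (swap_machines a) 1 1.
  by rewrite /= (CF_machine1_or_machine2 Ha (job1_in_N1 iN)).
exact: symmetry_breaking_job1 (CF_swap Ha) x12 i k iN.
Qed.
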